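(* For all integers $n \geq 1$ we have \[ |A_{2n}(2143)| = |\operatorname{SYT}(n, n, n)| = |A_{2n}(1234)| = \frac{2 \cdot (3n)!}{n!\,(n + 1)!\,(n + 2)!}. \]
   Context: A permutation $w = w_1w_2\cdots w_m$ of length $m$ is a word containing each element of $[m]=\{1,\dots,m\}$ exactly once. It is alternating if $w_1 < w_2 > w_3 < w_4 > \cdots$ (up-down convention); $A_m$ is the set of alternating permutations of length $m$. A permutation $w$ contains the pattern $p = p_1 \cdots p_k \in S_k$ if there are indices $i_1 < \cdots < i_k$ such that $w_{i_\ell} < w_{i_r}$ if and only if $p_\ell < p_r$; otherwise $w$ avoids $p$. $A_m(p)$ is the set of elements of $A_m$ that avoid $p$. $\operatorname{SYT}(n,n,n)$ is the set of standard Young tableaux of shape $\langle n,n,n\rangle$ (three rows of length $n$), i.e. fillings of the $3n$ boxes with the elements of $[3n]$, each used exactly once, with entries increasing along rows and columns. $|S|$ denotes the size of the set $S$. *)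

(* Defs.v *)
From mathcomp Require Import all_boot all_order all_algebra all_fingroup.

Set Implicit Arguments.
Unset Strict Implicit.
Unset Printing Implicit Defensive.

(* Indices and values are 0-based: w : 'S_m is the permutation word           *)
(* w_1 ... w_m with w_{i+1} = (w i).+1 for i < m.                             *)

Definition word m (w : 'S_m) : seq nat := [seq (w i : nat).+1 | i <- enum 'I_m].

(* w_1 < w_2 > w_3 < ... : ascents start at the even 0-based positions.       *)
Definition alternating m (w : 'S_m) : bool :=
  [forall i : 'I_m, forall j : 'I_m, (j == i.+1 :> nat) ==>
     (if odd i then w j < w i else w i < w j)].

Definition contains_pattern m k (w : 'S_m) (p : 'S_k) : bool :=
  [exists f : {ffun 'I_k -> 'I_m},
     [forall l : 'I_k, forall r : 'I_k, (l < r) ==> (f l < f r)] &&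
     [forall l : 'I_k, forall r : 'I_k, (w (f l) < w (f r)) == (p l < p r)]].

Definition avoids m k (w : 'S_m) (p : 'S_k) : bool := ~~ contains_pattern w p.

Definition alt_avoiding m k (p : 'S_k) : {set 'S_m} :=
  [set w : 'S_m | alternating w && avoids w p].

Definition p1234 : 'S_4 := 1%g.
Definition p2143 : 'S_4 :=
  (tperm (inord 0) (inord 1) * tperm (inord 2) (inord 3))%g.

Lemma word_p1234 : word p1234 = [:: 1; 2; 3; 4].
Proof.
rewrite /word (eq_map (g := S \o val)) => [|i /=]; last by rewrite perm1.
by rewrite map_comp val_enum_ord.
Qed.

Lemma word_p2143 : word p2143 = [:: 2; 1; 4; 3].
Proof.
rewrite /word (eq_map (g := (nth 0 [:: 2; 1; 4; 3]) \o val)).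
  by rewrite map_comp val_enum_ord.
by case=> -[|[|[|[|//]]]] lt_i4 /=;
  rewrite permM !permE /= -!val_eqE /= !inordK //= -!val_eqE /= ?inordK.
Qed.

(* Fillings T of the 3 x n boxes, T (row, column) being the entry minus one.  *)
Definition SYT_nnn n : {set {ffun 'I_3 * 'I_n -> 'I_(3 * n)}} :=
  [set T : {ffun 'I_3 * 'I_n -> 'I_(3 * n)} |
    [&& [forall v : 'I_(3 * n), #|[set b | T b == v]| == 1],
        [forall i : 'I_3, forall j : 'I_n, forall j' : 'I_n,
           (j < j') ==> (T (i, j) < T (i, j'))] &
        [forall i : 'I_3, forall i' : 'I_3, forall j : 'I_n,
           (i < i') ==> (T (i, j) < T (i', j))]]].

(* Main.v *)
(* The three families share one generating tree, with root labelled (1, 1)     *)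
(* and rule (a, b) -> {(x, y) : 2 <= x <= a + 1, x + 1 <= y <= b + 2}.          *)
(* An alternating permutation of length 2n+2 arises uniquely from one of       *)
(* length 2n by prepending an ascent c < d. For 2143 the new pair is allowed   *)
(* iff c and d are both active, and a = #(active gaps above the first letter), *)
(* b = #(active gaps); for 1234 it is allowed iff d starts no 123 and c starts *)
(* no 1234 in front of the old word, and a, b count the gaps allowed for d and *)
(* for c. A tableau is encoded by its ballot word and grows by a new last      *)
(* column; a - 1 and b - 1 are the numbers of entries exceeding the last entry *)
(* of the second and of the first row. Ballot words are then counted by their  *)
(* extremal letter, the hook formula solving the resulting recursion.          *)

Require Import Defs.
From mathcomp Require Import all_boot all_order all_algebra all_fingroup.
From mathcomp Require Import zify ring.
Import GRing.Theory.

(** The two permutation families and the tableaux grow level by level in trees whose nodes carry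
    pairs of integers. If the labels of the children depend only on the label of the parent, then
    level sizes depend only on the root label and the rule. So it suffices that
    [label_children1234], [label_children2143] and [label_children_word] produce the same [rule];
    [generating_tree] then equates the three cardinals with the size of [rule_level n].

    For permutations, prepending a pair of letters means choosing two gaps [c <= d] between the old
    values. Pattern avoidance restricts each gap separately, and the pair chosen determines which
    gaps remain available. For 1234 the available gaps form two final intervals
    ([chain_bound_ins2]); for 2143 they form a set that loses the gaps in [(c, d]] and keeps the
    others up to a shift ([active_ins2]). For tableaux, the freedom lies in how many entries are to
    exceed the new last entries of the first two rows.

    The closed formula is proved for ballot words of arbitrary content ([ballot_word_count]), since
    removing the largest entry of a tableau leaves the rectangular shape. [card_alt_avoiding] and
    [card_SYT_nnn] carry the counts of words over to the sets of the theorem. *)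

(** * The succession rule and generating trees *)

Definition rule (ab : nat * nat) : seq (nat * nat) :=
  [seq (x, y) | x <- iota 2 ab.1, y <- iota x.+1 (ab.2.+2 - x)].

Lemma mem_rule ab x y :
  ((x, y) \in rule ab) = [&& 2 <= x, x <= ab.1.+1, x < y & y <= ab.2.+2].
Proof.
apply/allpairsPdep/idP => [[x' [y' []]]|H].
  by rewrite !mem_iota => Hx Hy [-> ->]; lia.
by exists x, y; split=> //; rewrite mem_iota; lia.
Qed.

Lemma rule_uniq ab : uniq (rule ab).
Proof.
by apply: allpairs_uniq_dep => [|x _|[? ?] [? ?] _ _ /= [-> ->]//]; rewrite ?iota_uniq.
Qed.

Fixpoint rule_level n :=
  if n is n'.+1 then flatten [seq rule ab | ab <- rule_level n'] else [:: (1, 1)].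

Section GeneratingTree.

Variables (T : eqType) (P : nat -> T -> Prop) (root : T).
Variables (children : T -> seq T) (parent : T -> T) (label : T -> nat * nat).

Hypothesis rootP : forall x, P 0 x <-> x = root.
Hypothesis label_root : label root = (1, 1).
Hypothesis label_children :
  forall n x, P n x -> perm_eq (map label (children x)) (rule (label x)).
Hypothesis parentK : forall n x y, P n x -> y \in children x -> parent y = x.
Hypothesis childrenP :
  forall n y, P n.+1 y <-> exists2 x, P n x & y \in children x.

Lemma generating_tree n :
  exists s : seq T, [/\ uniq s, forall x, x \in s <-> P n x
                      & size s = size (rule_level n)].
Proof.
(* The induction needs the whole multiset of labels of a level, not just its size. *)
suff [s [us sP labs]] : exists s : seq T, [/\ uniq s, forall x, x \in s <-> P n x
    & perm_eq (map label s) (rule_level n)].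
  by exists s; split=> //; rewrite -(perm_size labs) size_map.
elim: n => [|n [s [us sP labs]]].
  exists [:: root]; split=> //= [x|]; last by rewrite label_root.
  by rewrite inE rootP; split=> /eqP.
exists (flatten (map children s)); split.
- have {labs}: forall x, x \in s -> P n x by move=> x /sP.
  elim: s us {sP} => //= x s IHs /andP[xs us] sP.
  have Px : P n x by apply: sP; rewrite mem_head.
  rewrite cat_uniq IHs ?andbT //; last by move=> y ys; apply: sP; rewrite inE ys orbT.
  apply/andP; split.
    (* Siblings are distinct because the rule never repeats a label. *)
    by apply: (@map_uniq _ _ label); rewrite (perm_uniq (label_children _ _ Px)) rule_uniq.
  apply/hasPn => y /flatten_mapP[z zs yz]; apply/negP => /= yx.
  have Pz : P n z by apply: sP; rewrite inE zs orbT.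
  by move: xs; rewrite -(parentK _ _ _ Px yx) (parentK _ _ _ Pz yz) zs.
- move=> y; rewrite childrenP; split.
    by case/flatten_mapP=> x /sP; exists x.
  by case=> x /sP xs yx; apply/flatten_mapP; exists x.
- rewrite /=; apply: perm_trans (perm_flatten (perm_map rule labs)).
  rewrite map_flatten -!map_comp.
  have {us labs}: forall x, x \in s -> P n x by move=> x /sP.
  elim: s {sP} => //= x s IHs sP.
  apply: perm_cat; first by apply: (label_children n); apply: sP; rewrite mem_head.
  by apply: IHs => y ys; apply: sP; rewrite inE ys orbT.
Qed.

End GeneratingTree.

(** * Permutations as words, and prepending letters *)

Definition perm_word (s : seq nat) := uniq s && all (gtn (size s)) s.

Lemma perm_word_mem s x : perm_word s -> (x \in s) = (x < size s).
Proof.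
case/andP=> us /allP ss.
have sub : {subset s <= iota 0 (size s)}.
  by move=> y /ss /= ?; rewrite mem_iota.
have [|_ ->] := uniq_min_size us sub; first by rewrite size_iota.
by rewrite mem_iota.
Qed.

(** The new first letter is given by the gap it occupies among the old values; [bump] makes room for
    it. *)
Definition ins v (s : seq nat) := v :: map (bump v) s.

Lemma perm_word_ins v s : perm_word (ins v s) = perm_word s && (v <= size s).
Proof.
rewrite /perm_word /= size_map (map_inj_uniq (can_inj (bumpK v))).
have -> : v \notin map (bump v) s.
  by apply/mapP => -[x _ /eqP]; rewrite (negPf (neq_bump _ _)).
rewrite ltnS andTb -andbA; congr (_ && _).
case: leqP => [vs|_]; last by rewrite andbF.
rewrite andbT all_map; apply: eq_all => x /=; rewrite /bump; lia.
Qed.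

Lemma perm_word_consP x u : perm_word (x :: u) ->
  exists s, [/\ u = map (bump x) s, perm_word s & x <= size s].
Proof.
move=> pw; have u_bump : u = map (bump x) (map (unbump x) u).
  rewrite -map_comp -[LHS]map_id; apply/eq_in_map => y yu /=.
  rewrite unbumpK // inE; apply: contraTneq yu => ->.
  by case/andP: pw => /= /andP[].
by exists (map (unbump x) u); move: pw; rewrite {1 2}u_bump perm_word_ins => /andP[].
Qed.

Definition first_lt (s : seq nat) v := if s is x :: _ then x < v else true.

Fixpoint alt_word (s : seq nat) :=
  if s is x :: y :: s' then [&& x < y, first_lt s' y & alt_word s'] else true.

(* [c] and [d] are gaps between the values of [s]; when [c = d] the new first *)
(* letter is the smaller one.                                                *)
Definition ins2 c d s := ins c (ins d s).

Lemma bump_ltE g x v : (bump g x < v) = (x < unbump g v).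
Proof. rewrite /bump /unbump; lia. Qed.

Lemma first_lt_bump g s v : first_lt (map (bump g) s) v = first_lt s (unbump g v).
Proof. by case: s => //= x s; rewrite bump_ltE. Qed.

Lemma alt_word_bump g s : alt_word (map (bump g) s) = alt_word s.
Proof.
have [n] := ubnP (size s); elim: n s => // n IHn [|x [|y s]] //= lt_s.
rewrite IHn; last by lia.
rewrite first_lt_bump bumpK; congr (_ && _); rewrite /bump; lia.
Qed.

Lemma alt_word_ins2 c d s :
  alt_word (ins2 c d s) = [&& c <= d, first_lt s d & alt_word s].
Proof.
rewrite /= !first_lt_bump !alt_word_bump bumpK; congr (_ && _).
  rewrite /bump; lia.
by congr (_ && _); rewrite /unbump ltnn subn0.
Qed.

Definition alt_perm_word n s := [&& perm_word s, size s == 2 * n & alt_word s].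

Lemma alt_perm_word0 s : alt_perm_word 0 s = (s == [::]).
Proof. by case: s => //= x s; rewrite /alt_perm_word muln0 andbF. Qed.

(** Removing two letters preserves the parity of positions, so the standardized rest is again
    up-down. The second letter ends up as [d.+1] once [c] is inserted, whence the weak inequality
    [c <= d]. *)
Lemma alt_perm_wordS n s : alt_perm_word n.+1 s <->
  exists u c d, [/\ s = ins2 c d u, alt_perm_word n u, c <= d, d <= size u & first_lt u d].
Proof.
split=> [/and3P[pw]|].
  case: s pw => // x s /perm_word_consP [s' [-> pw' xs' sz]].
  case: s' pw' sz xs' => [_|y u pw]; first by rewrite /=; lia.
  have [s' [-> pw' yu] sz xs] := perm_word_consP _ _ pw.
  rewrite (_ : _ :: _ = ins2 x y s') // alt_word_ins2 => /and3P[xy fl aw].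
  exists s', x, y; split=> //; rewrite /alt_perm_word pw' aw andbT.
  move: sz; rewrite /= !size_map; lia.
case=> u [c [d [-> /and3P[pw /eqP sz aw] cd du fl]]].
apply/and3P; split.
- by rewrite !perm_word_ins pw du /= size_map; lia.
- rewrite /= !size_map; lia.
- by rewrite alt_word_ins2 cd fl aw.
Qed.

Definition uninsert s := if s is v :: u then map (unbump v) u else [::].

Lemma insK v : cancel (ins v) uninsert.
Proof. by move=> s; rewrite /= (mapK (bumpK v)). Qed.

Lemma ins2K c d : cancel (ins2 c d) (uninsert \o uninsert).
Proof. by move=> s; rewrite /comp /ins2 !insK. Qed.

(** * The tree of alternating words avoiding 1234 *)

Ltac split_ifs := repeat match goal with |- context [if ?b then _ else _] =>
  lazymatch b with
  | context [if _ then _ else _] => fail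
  | _ => let H := fresh in case H: b
  end end.

(* [chain_bound k s] is the least [v] such that no increasing subsequence of   *)
(* length [k.+1] of [s] has all its values at least [v].                       *)
Fixpoint chain_bound k s {struct k} :=
  if k is k'.+1 then
    (fix bound s := if s is x :: s' then
       if x.+1 < chain_bound k' s' then maxn x.+1 (bound s') else bound s' else 0) s
  else foldr (fun x => maxn x.+1) 0 s.

Lemma chain_bound_cons k x s : chain_bound k.+1 (x :: s) =
  if x.+1 < chain_bound k s then maxn x.+1 (chain_bound k.+1 s) else chain_bound k.+1 s.
Proof. by []. Qed.

Lemma chain_boundP k s v : v < chain_bound k s <->
  exists y t, [/\ subseq (y :: t) s, path ltn y t, size t = k & v <= y].
Proof.
elim: k s v => [|k IHk] s v.
  elim: s => [|x s IHs] /=.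
    by split=> [//|[y [t []]]]; case: t.
  rewrite leq_max ltnS; split.
    case/orP=> [vx|/IHs[y [t [st pt szt vy]]]].
      by exists x, [::]; split; rewrite //= eqxx sub0seq.
    exists y, t; split=> //.
    by apply: subseq_trans st (subseq_cons _ _).
  case=> y [t [st pt /size0nil tE vy]]; subst t.
  move: st => /=; case: eqP => [<- _|_ ys]; first by rewrite vy.
  by apply/orP; right; apply/IHs; exists y, [::].
elim: s => [|x s IHs].
  by split=> [//|[y [t []]]]; case: t.
rewrite chain_bound_cons; split.
  have old : v < chain_bound k.+1 s -> exists y t,
      [/\ subseq (y :: t) (x :: s), path ltn y t, size t = k.+1 & v <= y].
    case/IHs=> y [t [st pt szt vy]]; exists y, t; split=> //.
    by apply: subseq_trans st (subseq_cons _ _).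
  case: ifP => // /IHk[y [t [st pt szt xy]]].
  rewrite leq_max ltnS => /orP[vx|//].
  by exists x, (y :: t); split; rewrite //= ?eqxx ?xy // szt.
case=> y [t [st pt szt vy]].
case: t szt st pt => [//|z t] [szt] st /= /andP[yz pt].
move: st; rewrite /= -/(subseq (z :: t) s) -/(subseq [:: y, z & t] s).
case: eqP => [yx|_] st.
  have: x.+1 < chain_bound k s by apply/IHk; exists z, t; rewrite -yx.
  by move=> ->; rewrite leq_max ltnS -yx vy.
have: v < chain_bound k.+1 s by apply/IHs; exists y, (z :: t); rewrite /= yz szt.
by case: ifP => // _; rewrite leq_max orbC => ->.
Qed.

(** Dropping the first entry of a chain shortens it by one and strictly raises its starting
    value. *)
Lemma chain_boundS k s : chain_bound k.+1 s <= (chain_bound k s).-1.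
Proof.
case E: (chain_bound k.+1 s) => [//|v].
have /chain_boundP[y [t [st pt szt vy]]]: v < chain_bound k.+1 s by rewrite E.
case: t szt st pt => [//|z t] [szt] st /= /andP[yz pt].
have: v.+1 < chain_bound k s; last by lia.
apply/chain_boundP; exists z, t; split=> //; last by lia.
by apply: subseq_trans st; apply: subseq_cons.
Qed.

Lemma chain_bound_bump g k s :
  chain_bound k (map (bump g) s) = chain_bound k s + (g < chain_bound k s).
Proof.
elim: k s => [|k IHk].
  by elim=> //= x s ->; rewrite /bump; lia.
elim=> // x s IHs.
rewrite map_cons !chain_bound_cons IHs IHk /bump.
by case: ifP => Ha; case: ifP => Hb; lia.
Qed.

Arguments chain_bound : simpl never.

Lemma chain_bound0_perm s : perm_word s -> chain_bound 0 s = size s.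
Proof.
move=> pw; have bnd v : (v < chain_bound 0 s) = (v < size s).
  apply/idP/idP=> [/chain_boundP[y [t [st _ /size0nil tE vy]]]|vs].
    move: st; rewrite tE sub1seq perm_word_mem //; lia.
  by apply/chain_boundP; exists v, [::]; rewrite sub1seq perm_word_mem.
by have := bnd (size s); have := bnd (chain_bound 0 s); lia.
Qed.

(* The numbers of gaps at which a value put in front of [s] starts no          *)
(* increasing subsequence of length 3, respectively 4.                        *)
Definition label1234 s := ((size s).+1 - chain_bound 1 s, (size s).+1 - chain_bound 2 s).

Definition alt1234 n s := alt_perm_word n s && (chain_bound 3 s == 0).

Definition children1234 s :=
  [seq ins2 cd.1 cd.2 s | cd <- [seq (c, d) | d <- iota (chain_bound 1 s) (label1234 s).1,
    c <- iota (chain_bound 2 s) (d.+1 - chain_bound 2 s)]].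

Lemma mem_pairs1234 s c d :
  ((c, d) \in [seq (c, d) | d <- iota (chain_bound 1 s) (label1234 s).1,
    c <- iota (chain_bound 2 s) (d.+1 - chain_bound 2 s)])
  = [&& chain_bound 1 s <= d, d <= size s, chain_bound 2 s <= c & c <= d].
Proof.
rewrite /label1234 /=.
apply/allpairsPdep/idP => [[d' [c' []]]|H].
  by rewrite !mem_iota /= => Hd Hc [-> ->]; lia.
by exists d, c; split=> //; rewrite mem_iota /=; lia.
Qed.

(** If [d] is not the top gap, some old letter lies above it, so the new second letter starts a 12
    and the first a 123; these start higher than all older chains. If [d] is the top gap, its letter
    only ends the ascent from [c], and the old chains still matter. *)
Lemma chain_bound_ins2 s c d : perm_word s -> c <= d <= size s ->
    chain_bound 1 s <= d -> chain_bound 2 s <= c ->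
  chain_bound 1 (ins2 c d s) =
    (if d < size s then d.+2 else maxn c.+1 (chain_bound 1 s + (c < chain_bound 1 s))) /\
  chain_bound 2 (ins2 c d s) =
    (if (d < size s) || (c < chain_bound 1 s) then c.+1 else chain_bound 2 s).
Proof.
move=> pw cd sd sc.
have sz := chain_bound0_perm _ pw.
rewrite /ins2 /ins map_cons !chain_bound_cons !chain_bound_bump sz /bump.
have := chain_boundS 0 s; have := chain_boundS 1 s; rewrite sz.
rewrite [chain_bound 0 (_ :: _)]/chain_bound /= -/(chain_bound 0 _).
move: (chain_bound 1 s) (chain_bound 2 s) sd sc => a b sd sc.
by split; split_ifs; lia.
Qed.

(** A 123 starting at the second letter is completed to a 1234 by the first one; otherwise a new
    1234 consists of the first letter and a 123 of [s]. *)
Lemma chain_bound3_ins2 s c d : perm_word s -> c <= d <= size s ->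
  (chain_bound 3 (ins2 c d s) == 0) =
    [&& chain_bound 3 s == 0, chain_bound 1 s <= d & chain_bound 2 s <= c].
Proof.
move=> pw cd.
have sz := chain_bound0_perm _ pw.
rewrite /ins2 /ins map_cons !chain_bound_cons !chain_bound_bump /bump.
have := chain_boundS 0 s; have := chain_boundS 1 s; have := chain_boundS 2 s; rewrite sz.
move: (chain_bound 1 s) (chain_bound 2 s) (chain_bound 3 s) => a b e.
by split_ifs; lia.
Qed.

Lemma label_children1234 n s : alt1234 n s ->
  perm_eq (map label1234 (children1234 s)) (rule (label1234 s)).
Proof.
case/andP=> /and3P[pw _ _] _; rewrite -map_comp.
have b1 : chain_bound 1 s <= size s.
  by have := chain_boundS 0 s; rewrite (chain_bound0_perm _ pw); lia.
have b2 := chain_boundS 1 s.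
set pairs := [seq (c, d) | d <- _, c <- _].
pose m := size s; pose a := chain_bound 1 s; pose b := chain_bound 2 s.
(* With [(A, B)] the label of [s], the three cases fill disjoint pieces of the rule: [x <= A] and
   [y <= B + 1]; then [x = A + 1] and [y <= B + 1]; then [y = B + 2]. *)
pose g cd := if cd.2 < m then (m.+1 - cd.2, m.+2 - cd.1)
  else if cd.1 < a then (m.+2 - a, m.+2 - cd.1) else (m.+2 - cd.1, m.+3 - b).
have /eq_in_map -> : {in pairs, (label1234 \o (fun cd => ins2 cd.1 cd.2 s)) =1 g}.
  case=> c d; rewrite mem_pairs1234 => /and4P[ad dm bc cd].
  have cdm : c <= d <= size s by lia.
  have [e1 e2] := chain_bound_ins2 _ _ _ pw cdm ad bc.
  rewrite /= /label1234 e1 e2 /= !size_map /g /m /a /b /=.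
  by case: ltnP => //= md; case: ltnP => //= ca; congr (_, _); lia.
have mE : m = size s by [].
have aE : a = chain_bound 1 s by [].
have bE : b = chain_bound 2 s by [].
apply: uniq_perm; last 2 first.
- exact: rule_uniq.
- case=> x y; rewrite mem_rule /label1234 /=; apply/mapP/idP => [[[c d]]|H].
    rewrite mem_pairs1234 /g /= -/m -/a -/b => H.
    by case: ifP => ?; [|case: ifP => ?] => -[-> ->]; lia.
  have [yb|yb] := ltnP y (m.+3 - b); last first.
    exists (m.+2 - x, m); first by rewrite mem_pairs1234; lia.
    by rewrite /g /= ltnn ifF; [congr (_, _)|]; lia.
  have [xa|xa] := ltnP x (m.+2 - a); last first.
    exists (m.+2 - y, m); first by rewrite mem_pairs1234; lia.
    by rewrite /g /= ltnn ifT; [congr (_, _)|]; lia.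
  exists (m.+2 - y, m.+1 - x); first by rewrite mem_pairs1234; lia.
  by rewrite /g /= ifT; [congr (_, _)|]; lia.
rewrite map_inj_in_uniq.
  apply: allpairs_uniq_dep => [|d _|[? ?] [? ?] _ _ /= [-> ->]//]; exact: iota_uniq.
case=> c d [c' d']; rewrite !mem_pairs1234 /g /= => H H'.
by do 4?case: ifP => ?; case=> *; congr (_, _); lia.
Qed.

Lemma alt1234_tree n : exists L : seq (seq nat),
  [/\ uniq L, forall s, s \in L <-> alt1234 n s & size L = size (rule_level n)].
Proof.
apply: (generating_tree _ alt1234 [::] children1234 (uninsert \o uninsert) label1234) => //.
- by move=> s; rewrite /alt1234 alt_perm_word0; split=> [/andP[/eqP]|->].
- exact: label_children1234.
- by move=> {}n s t _ /mapP[cd _ ->]; rewrite ins2K.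
move=> {}n t; split.
  case/andP=> /alt_perm_wordS[s [c [d [-> ps cd ds _]]]].
  have pw : perm_word s by case/and3P: ps.
  rewrite chain_bound3_ins2 ?cd // => /and3P[ts ad bc].
  exists s; first by rewrite /alt1234 ps.
  by apply/mapP; exists (c, d); rewrite // mem_pairs1234 ad ds bc.
case=> s /andP[ps ts] /mapP[[c d]].
rewrite mem_pairs1234 => /and4P[ad ds bc cd] ->.
have pw : perm_word s by case/and3P: ps.
rewrite /alt1234 chain_bound3_ins2 ?cd // ts ad bc !andbT.
apply/alt_perm_wordS; exists s, c, d; split=> //.
(* The descent from [d] to the old first letter is automatic: the old word begins with an ascent
   [x < y], so [x < chain_bound 1 s <= d]. *)
case: s ps ad {ts ds bc pw} => //= x [|y s]; first by case/and3P=> _ /eqP /=; lia.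
case/and3P=> _ _ /and3P[xy _ _] ad; apply: leq_trans ad.
apply/chain_boundP; exists x, [:: y].
by rewrite /= !eqxx xy sub0seq.
Qed.

(** * The tree of alternating words avoiding 2143, with active gaps counted by rank *)

Section CountBelow.

Variable a : pred nat.

Definition rank v := count a (iota 0 v).

Lemma rankS v : rank v.+1 = rank v + a v.
Proof. by rewrite /rank -addn1 iotaD count_cat /= addn0. Qed.

Lemma rank_mono u v : u <= v -> rank u <= rank v.
Proof. by move/subnKC <-; rewrite /rank iotaD count_cat leq_addr. Qed.

Lemma rank_lt u v : a u -> u < v -> rank u < rank v.
Proof. by move=> au /rank_mono; rewrite rankS au; lia. Qed.

Lemma rank_inj u v : a u -> a v -> rank u = rank v -> u = v.
Proof.
move=> au av; case: (ltngtP u v) => // [/(rank_lt _ _ au)|/(rank_lt _ _ av)]; lia.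
Qed.

Lemma rank_surj k m : k < rank m -> exists v, [/\ v < m, a v & rank v = k].
Proof.
elim: m => // m IHm; rewrite rankS => km; have [/IHm[v [vm av <-]]|mk] := ltnP k (rank m).
  by exists v; split=> //; lia.
by exists m; split; lia.
Qed.

Lemma count_iota u n : count a (iota u n) = rank (u + n) - rank u.
Proof. by rewrite /rank iotaD count_cat add0n addKn. Qed.

End CountBelow.

(* Least [v] such that no element of [s] lies in [v, y). *)
Definition below_bound y s := foldr (fun z b => if z < y then maxn z.+1 b else b) 0 s.

(* Least [v] such that [s] has no inversion with both values at least [v]. *)
Fixpoint inv_bound s :=
  if s is y :: s' then maxn (below_bound y s') (inv_bound s') else 0.

(* No 132-pattern [b d c] of [s] has [b < v <= c], i.e. the value inserted at *)
(* [v] in front of [s] does not start a 2143-pattern.                         *)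
Fixpoint active s v :=
  if s is x :: s' then active s' v && ((x < v) ==> (inv_bound s' <= v)) else true.

Fixpoint avoids2143 s :=
  if s is x :: s' then avoids2143 s' && active s' x else true.

Lemma below_bound_bump g y s : below_bound (bump g y) (map (bump g) s) =
  below_bound y s + (g < below_bound y s).
Proof.
elim: s => //= z s ->; rewrite /bump.
by move: (below_bound y s) => b; split_ifs; lia.
Qed.

Lemma inv_bound_bump g s : inv_bound (map (bump g) s) = inv_bound s + (g < inv_bound s).
Proof. by elim: s => //= y s ->; rewrite below_bound_bump; lia. Qed.

Lemma active_bump g s v : active (map (bump g) s) v = active s (unbump g v).
Proof.
elim: s => //= x s ->; rewrite inv_bound_bump bump_ltE; congr (_ && (_ ==> _)).
rewrite /unbump; lia.
Qed.

Lemma active_ins c s v : active (ins c s) v =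
  active s (unbump c v) && ((c < v) ==> (inv_bound s + (c < inv_bound s) <= v)).
Proof. by rewrite /= active_bump inv_bound_bump. Qed.

Lemma avoids2143_bump g s : avoids2143 (map (bump g) s) = avoids2143 s.
Proof. by elim: s => //= x s ->; rewrite active_bump bumpK. Qed.

(** The second letter never takes part in a 2143 starting at the first: it is too large to be the 1,
    and stands too early to be the 4 or the 3. So each new letter is tested against [s] alone. *)
Lemma avoids2143_ins2 s c d : c <= d ->
  avoids2143 (ins2 c d s) = [&& avoids2143 s, active s c & active s d].
Proof.
move=> cd; rewrite /= !avoids2143_bump !active_bump inv_bound_bump bumpK.
have -> : unbump d (unbump c c) = c by rewrite /unbump; lia.
have -> : unbump d d = d by rewrite /unbump ltnn subn0.
rewrite -andbA; congr (_ && _); rewrite andbC.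
case: (active s c) => //=; rewrite [X in X && _](_ : _ = true) //; rewrite /bump; lia.
Qed.

Lemma below_boundP y s v : v < below_bound y s <-> exists2 z, z \in s & v <= z < y.
Proof.
elim: s => [|x s IHs] /=; first by split=> // -[].
have old : v < below_bound y s -> exists2 z, z \in x :: s & v <= z < y.
  by case/IHs=> z zs ?; exists z; rewrite // inE zs orbT.
split.
  case: ifP => // xy; rewrite leq_max ltnS => /orP[vx|//].
  by exists x; rewrite ?mem_head ?vx.
case=> z; rewrite inE => /predU1P[-> /andP[vx ->]|zs vzy].
  by rewrite leq_max ltnS vx.
have/IHs : exists2 z, z \in s & v <= z < y by exists z.
by case: ifP => // _; rewrite leq_max orbC => ->.
Qed.

Lemma below_bound_le y s : below_bound y s <= y.
Proof. by elim: s => //= z s; case: ifP => //; rewrite geq_max => ->. Qed.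

Lemma below_bound_perm d s : perm_word s -> d <= size s ->
  below_bound d (map (bump d) s) = d.
Proof.
move=> pw ds; apply/eqP; rewrite eqn_leq below_bound_le /=.
case: d ds => // d ds; apply/below_boundP; exists d; last by rewrite !leqnn.
by apply/mapP; exists d; rewrite ?perm_word_mem // /bump; lia.
Qed.

(** The first letter lies below [d], so it could serve as the 1 before any later inversion at or
    above [d], and it starts no such inversion itself. *)
Lemma inv_bound_active s d : active s d -> first_lt s d -> inv_bound s <= d.
Proof.
case: s => //= x s /andP[_ /implyP act_d] xd.
by rewrite geq_max act_d // andbT; apply: leq_trans (below_bound_le _ _) (ltnW xd).
Qed.

(** A gap in [(c, d]] dies: [c] lies below it, and the second letter [d.+1] forms an inversion with
    the later letter [d]. Above [d] the two new letters create no obstruction, and old gaps move up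
    by 2; the old gap [d] splits into [d.+1] and [d.+2]. *)
Lemma active_ins2 s c d v : perm_word s -> c <= d <= size s ->
    active s d -> first_lt s d ->
  active (ins2 c d s) v =
    if v <= c then active s v else (v == d.+1) || (d.+1 < v) && active s (v - 2).
Proof.
move=> pw /andP[cd ds] act_d fl_d; have inv_d := inv_bound_active _ _ act_d fl_d.
have inv_ins : inv_bound (ins d s) = d.
  by rewrite /= below_bound_perm // inv_bound_bump; lia.
rewrite /ins2 active_ins inv_ins active_ins.
have [vc|cv] := leqP v c.
  have -> : unbump d (unbump c v) = v by rewrite /unbump; lia.
  by rewrite /unbump; case: (active s v) => //; lia.
have [vd|dv|->] := ltngtP v d.+1.
- by rewrite implyTb; lia.
- have -> : unbump d (unbump c v) = v - 2 by rewrite /unbump; lia.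
  by case: (active s _) => //=; rewrite /unbump; lia.
- have -> : unbump d (unbump c d.+1) = d by rewrite /unbump; lia.
  by rewrite act_d /unbump; lia.
Qed.

Definition active_gaps s := [seq v <- iota 0 (size s).+1 | active s v].

Definition label2143 s := (count (first_lt s) (active_gaps s), size (active_gaps s)).

Definition alt2143 n s := alt_perm_word n s && avoids2143 s.

Definition pairs2143 s :=
  [seq (c, d) | d <- filter (first_lt s) (active_gaps s), c <- filter (geq d) (active_gaps s)].

Definition children2143 s := [seq ins2 cd.1 cd.2 s | cd <- pairs2143 s].

Lemma mem_pairs2143 s c d : ((c, d) \in pairs2143 s) =
  [&& active s c, active s d, c <= d, d <= size s & first_lt s d].
Proof.
apply/allpairsPdep/idP => [[d' [c' []]]|/and5P[ac ad cd ds fd]].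
  rewrite !mem_filter !mem_iota => /and3P[fl ad Hd] /and3P[/= dc ac Hc] [-> ->].
  by rewrite ac ad dc fl; lia.
exists d, c; split=> //; rewrite !mem_filter mem_iota.
  by rewrite fd ad; lia.
by rewrite /= cd ac; lia.
Qed.

Lemma pairs2143_uniq s : uniq (pairs2143 s).
Proof.
by apply: allpairs_uniq_dep => [|d _|[? ?] [? ?] _ _ /= [-> ->]//];
  rewrite !filter_uniq ?iota_uniq.
Qed.

Arguments active : simpl never.

Lemma label2143E s : label2143 s =
  (count (predI (first_lt s) (active s)) (iota 0 (size s).+1), rank (active s) (size s).+1).
Proof. by rewrite /label2143 count_filter size_filter. Qed.

(** Above the new first letter [c], the active gaps are [d.+1] and the shifted old ones from [d] on;
    at or below [c] they are the old ones. *)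
Lemma label2143_ins2 s c d : perm_word s -> (c, d) \in pairs2143 s ->
  label2143 (ins2 c d s) =
    ((rank (active s) (size s).+1 - rank (active s) d).+1,
     (rank (active s) c).+1 + (rank (active s) (size s).+1 - rank (active s) d).+1).
Proof.
move=> pw; rewrite mem_pairs2143 => /and5P[ac ad cd ds fd].
have cds : c <= d <= size s by rewrite cd.
have actE v := active_ins2 _ _ _ v pw cds ad fd.
have upper a : {in iota c.+1 (d - c), a =1 pred0} -> a d.+1 ->
    {in iota d.+2 ((size s).+1 - d), forall v, a v = active s (v - 2)} ->
    count a (iota c.+1 ((size s).+2 - c)) =
    (rank (active s) (size s).+1 - rank (active s) d).+1.
  move=> a0 a1 a2.
  have -> : (size s).+2 - c = (d - c) + (1 + ((size s).+1 - d)) by lia.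
  rewrite !iotaD !count_cat (eq_in_count a0) count_pred0.
  have -> : c.+1 + (d - c) = d.+1 by lia.
  rewrite /= a1 addn1 (eq_in_count a2) add0n add1n; congr _.+1.
  rewrite -[d.+2]/(2 + d) iotaDl count_map.
  rewrite (eq_count (a2 := active s)) => [|v]; last by rewrite /= addKn.
  by rewrite count_iota subnKC //; lia.
have mid v : v \in iota c.+1 (d - c) -> active (ins2 c d s) v = false.
  by rewrite mem_iota actE => Hv; rewrite ifF; lia.
have mid1 : active (ins2 c d s) d.+1 by rewrite actE ifF ?eqxx //; lia.
have high v : v \in iota d.+2 ((size s).+1 - d) ->
    active (ins2 c d s) v = active s (v - 2).
  rewrite mem_iota actE => Hv; rewrite ifF; last by lia.
  by rewrite (_ : v == d.+1 = false) /= 1?(_ : d.+1 < v) //; lia.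
have sizeE : (size (ins2 c d s)).+1 = c.+1 + ((size s).+2 - c).
  by rewrite /= !size_map; lia.
rewrite label2143E sizeE /rank !iotaD !count_cat add0n -![count (active s) _]/(rank _ _).
rewrite !upper //.
- congr (_, _).
  + rewrite (eq_in_count (a2 := pred0)) ?count_pred0 // => v.
    by rewrite mem_iota /= => Hv; rewrite (_ : c < v = false) //; lia.
  + congr (_ + _).
    have -> : (rank (active s) c).+1 = rank (active s) c.+1 by rewrite rankS ac addn1.
    by apply: eq_in_count => v; rewrite mem_iota actE => Hv; rewrite ifT //; lia.
- by move=> v /mid /= ->; rewrite andbF.
- by rewrite /= mid1 andbT; lia.
- move=> v Hv; rewrite /= -high //; move: Hv; rewrite mem_iota => Hv.
  by rewrite (_ : c < v) //; lia.
Qed.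

Lemma label_children2143 n s : alt2143 n s ->
  perm_eq (map label2143 (children2143 s)) (rule (label2143 s)).
Proof.
case/andP=> /and3P[pw _ _] _; rewrite -map_comp.
pose N := rank (active s); pose m := size s; pose T := N m.+1.
pose g cd := ((T - N cd.2).+1, (N cd.1).+1 + (T - N cd.2).+1).
have /eq_in_map -> : {in pairs2143 s, (label2143 \o (fun cd => ins2 cd.1 cd.2 s)) =1 g}.
  by case=> c d cd; rewrite /= label2143_ins2.
(* Being above the first letter is a threshold condition, with threshold 0 for the empty word. *)
have [f fP fm] : exists2 f, forall v, first_lt s v = (f <= v) & f <= m.
  rewrite /m; case: (s) pw => [|x s'] pw'; first by exists 0.
  by exists x.+1; rewrite // -perm_word_mem ?mem_head.
have N_mono u v : u <= v -> N u <= N v by apply: rank_mono.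
have lab1 : (label2143 s).1 = T - N f.
  rewrite label2143E -[LHS]/(count _ (iota 0 m.+1)) -(subnKC (leqW fm)) iotaD count_cat add0n.
  rewrite (eq_in_count (a2 := pred0)) ?count_pred0; last first.
    by move=> v; rewrite mem_iota /= fP; lia.
  rewrite (eq_in_count (a2 := active s)) ?count_iota ?subnKC //; first by lia.
  by move=> v; rewrite mem_iota /= fP => /andP[-> _].
have lab2 : (label2143 s).2 = T by rewrite label2143E.
apply: uniq_perm; last 2 first.
- exact: rule_uniq.
- case=> x y; rewrite mem_rule lab1 lab2; apply/mapP/idP => [[[c d]]|H].
    rewrite mem_pairs2143 fP /g /= => /and5P[ac ad cd ds fd] [-> ->].
    have := rank_lt _ _ _ ad (leq_ltn_trans ds (ltnSn _)); rewrite -/N -/T => ?.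
    by have := N_mono _ _ cd; have := N_mono _ _ fd; lia.
  (* The label coordinate [x] fixes the rank of [d] among active gaps, and then [y - x] fixes that
     of [c]. *)
  have [d [dm ad Nd]] : exists d, [/\ d < m.+1, active s d & rank (active s) d = T.+1 - x].
    by apply: rank_surj; rewrite -/N -/T; lia.
  have [c [cd ac Nc]] : exists c, [/\ c < d.+1, active s c & rank (active s) c = y - x.+1].
    by apply: rank_surj; rewrite rankS ad Nd; lia.
  exists (c, d).
    rewrite mem_pairs2143 ac ad fP -[c <= d]ltnS -[d <= _]ltnS cd dm /= leqNgt.
    apply/negP => df.
    by have := rank_lt _ _ _ ad df; rewrite Nd -/N; lia.
  by rewrite /g /N /= Nd Nc; congr (_, _); lia.
rewrite map_inj_in_uniq ?pairs2143_uniq // => -[c d] [c' d'].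
rewrite !mem_pairs2143 /g /= => /and5P[ac ad cd ds _] /and5P[ac' ad' cd' ds' _] [] E1 E2.
have := rank_lt _ _ _ ad (leq_ltn_trans ds (ltnSn _)).
have := rank_lt _ _ _ ad' (leq_ltn_trans ds' (ltnSn _)); rewrite -/N -/T => ? ?.
by congr (_, _); apply: (rank_inj (active s)) => //; rewrite -/N; lia.
Qed.

Lemma alt2143_tree n : exists L : seq (seq nat),
  [/\ uniq L, forall s, s \in L <-> alt2143 n s & size L = size (rule_level n)].
Proof.
apply: (generating_tree _ alt2143 [::] children2143 (uninsert \o uninsert) label2143) => //.
- by move=> s; rewrite /alt2143 alt_perm_word0; split=> [/andP[/eqP]|->].
- exact: label_children2143.
- by move=> {}n s t _ /mapP[cd _ ->]; rewrite ins2K.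
move=> {}n t; split.
  case/andP=> /alt_perm_wordS[s [c [d [-> ps cd ds fd]]]].
  rewrite avoids2143_ins2 // => /and3P[ts ac ad].
  exists s; first by rewrite /alt2143 ps.
  by apply/mapP; exists (c, d); rewrite // mem_pairs2143; apply/and5P.
case=> s /andP[ps ts] /mapP[[c d]].
rewrite mem_pairs2143 => /and5P[ac ad cd ds fd] ->.
rewrite /alt2143 avoids2143_ins2 // ts ac ad !andbT.
by apply/alt_perm_wordS; exists s, c, d.
Qed.

(** * The tree of ballot words *)

Definition occ (x : nat) (r : seq nat) : nat := count_mem x r.

Lemma occ_cons x y r : occ x (y :: r) = (y == x) + occ x r.
Proof. by []. Qed.

Lemma occ_cat x r t : occ x (r ++ t) = occ x r + occ x t.
Proof. exact: count_cat. Qed.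

Lemma occ_gt0 x r : (0 < occ x r) = (x \in r).
Proof. by rewrite -has_count has_pred1. Qed.

Lemma occ_notin x r : x \notin r -> occ x r = 0.
Proof. by move/count_memPn. Qed.

Arguments occ : simpl never.

Fixpoint ballot_from i j k (r : seq nat) :=
  if r is _ :: r' then
    [&& ballot_from i j k r', k + occ 2 r <= j + occ 1 r
      & j + occ 1 r <= i + occ 0 r]
  else true.

(* Letter [i] stands for row [i] of a tableau, and words are read from right  *)
(* to left: the last letter of the word is the row of the smallest entry.     *)
Definition ballot := ballot_from 0 0 0.

Definition content a b c r :=
  [&& size r == a + b + c, occ 0 r == a, occ 1 r == b & occ 2 r == c].

Definition ballot_word a b c r := ballot r && content a b c r.

Lemma ballot_from_cat i j k u v : ballot_from i j k (u ++ v) =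
  ballot_from i j k v
  && ballot_from (i + occ 0 v) (j + occ 1 v) (k + occ 2 v) u.
Proof.
elim: u => [|x u IHu] /=; first by rewrite andbT.
rewrite IHu !occ_cons !occ_cat -andbA. congr [&& _, _ & _]; congr andb; congr leq; lia.
Qed.

(** While no 0 is read, the count of 1s only grows, so its bound at the end implies all earlier
    ones. *)
Lemma ballot_from_no0 i i' j k (u : seq nat) : 0 \notin u ->
  j + occ 1 u <= i -> j + occ 1 u <= i' ->
  ballot_from i j k u = ballot_from i' j k u.
Proof.
elim: u => //= x u IHu; rewrite !occ_cons inE negb_or => /andP[x0 u0] ji ji'.
by rewrite IHu //; [congr [&& _, _ & _] | |]; lia.
Qed.

Lemma ballot_from_no01 i j k (u : seq nat) : 0 \notin u -> 1 \notin u ->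
  k + occ 2 u <= j <= i -> ballot_from i j k u.
Proof.
elim: u => //= x u IHu; rewrite !occ_cons !inE !negb_or => /andP[x0 u0] /andP[x1 u1] H.
have u1' := occ_notin _ _ u1; have u0' := occ_notin _ _ u0.
by rewrite IHu //=; rewrite ?u0' ?u1'; lia.
Qed.

Lemma ballot_le u : ballot u -> occ 2 u <= occ 1 u <= occ 0 u.
Proof. by case: u => //= x u /and3P[_ H1 H2]; apply/andP. Qed.

Lemma ballot_catr u v : ballot (u ++ v) -> ballot v.
Proof. by rewrite /ballot ballot_from_cat => /andP[]. Qed.

(* [r3 ++ r2 ++ r1] after adding to the tableau a last column, whose entries   *)
(* are the largest of their rows.                                             *)
Definition insert_column (r1 r2 r3 : seq nat) : seq nat := 2 :: r3 ++ 1 :: r2 ++ 0 :: r1.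

Lemma occ_insert_column x (r1 r2 r3 : seq nat) : occ x (insert_column r1 r2 r3) =
  (0 == x) + (1 == x) + (2 == x) + occ x (r3 ++ r2 ++ r1).
Proof. by rewrite /insert_column !(occ_cons, occ_cat); lia. Qed.

Lemma content_insert_column n (r1 r2 r3 : seq nat) :
  content n.+1 n.+1 n.+1 (insert_column r1 r2 r3) = content n n n (r3 ++ r2 ++ r1).
Proof.
rewrite /content !occ_insert_column /= !size_cat /= !size_cat /=.
by congr [&& _, _, _ & _]; lia.
Qed.

(** All [n] old 0s are read before the new 0, and all [n] old 1s before the new 1; from there on the
    inequalities concerned hold by total content in both words. *)
Lemma ballot_insert_column n (r1 r2 r3 : seq nat) : 0 \notin r2 -> 0 \notin r3 -> 1 \notin r3 ->
  content n n n (r3 ++ r2 ++ r1) ->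
  ballot (insert_column r1 r2 r3) = ballot (r3 ++ r2 ++ r1).
Proof.
move=> r20 r30 r31 /and4P[_].
have r20' := occ_notin _ _ r20; have r30' := occ_notin _ _ r30.
have r31' := occ_notin _ _ r31.
rewrite !occ_cat r20' r30' r31' !add0n => /eqP c0 /eqP c1 /eqP c2.
rewrite /ballot /insert_column /= !ballot_from_cat /= !ballot_from_cat /=.
rewrite !occ_cons !occ_cat !occ_cons !occ_cat !occ_cons /=.
rewrite r20' r30' r31' !add0n.
rewrite (ballot_from_no0 (1 + occ 0 r1) (occ 0 r1)) //; try lia.
have [b1 /=|//] := boolP (ballot_from 0 0 0 r1).
have := ballot_le _ b1.
have [b2 /=|] := boolP (ballot_from _ _ _ r2); last by rewrite !andbF.
by move=> b1'; rewrite !ballot_from_no01 //; lia.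
Qed.

Lemma split_first (T : eqType) (x : T) s : x \in s ->
  exists s1 s2, s = s1 ++ x :: s2 /\ x \notin s1.
Proof.
elim: s => // y s IHs; rewrite inE; case: eqVneq => [-> _|xy /= /IHs[s1 [s2 [-> xs1]]]].
  by exists [::], s.
by exists (y :: s1), s2; rewrite inE negb_or xy.
Qed.

Lemma rem_first (T : eqType) (x : T) s1 s2 : x \notin s1 ->
  rem x (s1 ++ x :: s2) = s1 ++ s2.
Proof.
elim: s1 => [|y s1 IHs] /=; first by rewrite eqxx.
by rewrite inE negb_or eq_sym => /andP[/negPf-> /IHs->].
Qed.

Lemma occ012 (r : seq nat) : occ 0 r + occ 1 r + occ 2 r <= size r.
Proof. by elim: r => //= x r; rewrite !occ_cons; lia. Qed.

Lemma ballot_word_column n r : ballot_word n.+1 n.+1 n.+1 r -> exists r1 r2 r3,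
  [/\ r = insert_column r1 r2 r3, 0 \notin r2, 0 \notin r3 & 1 \notin r3].
Proof.
case: r => [|x r] /andP[br /and4P[/eqP sz /eqP c0 /eqP c1 /eqP c2]] //.
have br' : ballot r by case/and3P: br.
have le_r := ballot_le _ br'.
have := occ012 r; move: sz c0 c1 c2; rewrite !occ_cons => /= sz c0 c1 c2 sz'.
(* Removing a 0 or a 1 from equal counts would break the ballot condition of the tail. *)
have x2 : x = 2 by case: x {br} sz c0 c1 c2 => [|[|[|x]]] //=; lia.
rewrite {x br}x2 /= in sz c0 c1 c2 *.
have /split_first[r3 [u [ru r31]]] : 1 \in r by rewrite -occ_gt0; lia.
have r31' := occ_notin _ _ r31.
(* The suffix [1 :: u] holds every 1, hence by the ballot condition every 0, so [r3] has none. *)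
have := ballot_le (1 :: u).
rewrite ru in br' c0 c1; rewrite (ballot_catr _ _ br') => /(_ isT).
move: c0 c1; rewrite !(occ_cat, occ_cons) r31' /= => c0 c1 Hu.
have r30 : 0 \notin r3 by rewrite -occ_gt0; lia.
have /split_first[r2 [r1 [ur r20]]] : 0 \in u by rewrite -occ_gt0; lia.
by exists r1, r2, r3; rewrite ru ur.
Qed.

Definition label_word r := ((index 1 r).+1, (index 0 r).+1).

(** The cut points of [r = r3 ++ r2 ++ r1]: [Y] is the length of [r3] and [X] that of [r3 ++ r2].
    The bounds keep 0 out of both blocks and 1 out of [r3]. *)
Definition column_pairs r :=
  [seq (X, Y) | X <- iota 0 (index 0 r).+1, Y <- iota 0 (minn X (index 1 r)).+1].

Definition children_word r :=
  [seq insert_column (drop XY.1 r) (take (XY.1 - XY.2) (drop XY.2 r)) (take XY.2 r)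
     | XY <- column_pairs r].

Lemma mem_column_pairs r X Y : ((X, Y) \in column_pairs r) =
  [&& X <= index 0 r, Y <= X & Y <= index 1 r].
Proof.
apply/allpairsPdep/idP => [[X' [Y' []]]|H].
  by rewrite !mem_iota /= => HX HY [-> ->]; lia.
by exists X, Y; rewrite !mem_iota; split=> //; lia.
Qed.

Lemma notin_take (x : nat) n s : n <= index x s -> x \notin take n s.
Proof.
move=> nx; rewrite in_take_leq -?leqNgt //.
by apply: leq_trans nx (index_size _ _).
Qed.

Lemma column_pair_cat (r : seq nat) X Y : Y <= X ->
  take Y r ++ take (X - Y) (drop Y r) ++ drop X r = r.
Proof.
move=> YX; rewrite -[in drop X r](subnK YX) -drop_drop cat_take_drop.
by rewrite cat_take_drop.
Qed.

Lemma column_pairP r X Y : (X, Y) \in column_pairs r ->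
  [/\ 0 \notin take (X - Y) (drop Y r), 0 \notin take Y r & 1 \notin take Y r].
Proof.
rewrite mem_column_pairs => /and3P[X0 YX Y1].
have tX : 0 \notin take X r by apply: notin_take.
split; last 2 first.
- by apply: notin_take; apply: leq_trans X0.
- exact: notin_take.
- apply: contra tX; rewrite take_drop subnK //; exact: mem_drop.
Qed.

Lemma children_wordP r t :
  t \in children_word r <-> exists r1 r2 r3,
    [/\ r = r3 ++ r2 ++ r1, t = insert_column r1 r2 r3
      & [/\ 0 \notin r2, 0 \notin r3 & 1 \notin r3]].
Proof.
split.
  case/mapP=> -[X Y] XY ->; do 3!eexists; split; [|by []|exact: column_pairP].
  by move: XY; rewrite mem_column_pairs => /and3P[_ YX _]; rewrite column_pair_cat.
case=> r1 [r2 [r3 [-> -> [r20 r30 r31]]]].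
apply/mapP; exists (size r3 + size r2, size r3).
  rewrite mem_column_pairs !index_cat (negPf r20) (negPf r30) (negPf r31).
  by rewrite leq_add2l !leq_addr.
by rewrite /= addKn addnC -drop_drop !drop_size_cat // !take_size_cat.
Qed.

Lemma label_children_word r :
  perm_eq (map label_word (children_word r)) (rule (label_word r)).
Proof.
rewrite -map_comp.
have /eq_in_map -> : {in column_pairs r, (label_word \o (fun XY =>
    insert_column (drop XY.1 r) (take (XY.1 - XY.2) (drop XY.2 r)) (take XY.2 r)))
    =1 fun XY => (XY.2.+2, XY.1.+3)}.
  case=> X Y XY; have [h20 h30 h31] := column_pairP _ _ _ XY.
  rewrite /label_word /insert_column /= !index_cat (negPf h30) (negPf h31) /=.
  rewrite !index_cat (negPf h20) /= addn0.
  move: XY; rewrite mem_column_pairs => /and3P[X0 YX Y1].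
  have sX := leq_trans X0 (index_size _ _).
  rewrite !size_takel ?size_drop ?leq_sub2r //; last exact: leq_trans YX sX.
  by rewrite addn0 addnS subnKC.
apply: uniq_perm; last 2 first.
- exact: rule_uniq.
- case=> x y; rewrite mem_rule [_.1]/= [_.2]/=; apply/mapP/idP => [[[X Y]]|H].
    by rewrite mem_column_pairs => ? [-> ->]; lia.
  by exists (y - 3, x - 2); rewrite ?mem_column_pairs /=; [|congr (_, _)]; lia.
rewrite map_inj_uniq; last by case=> ? ? [? ?] /= [-> ->].
apply: allpairs_uniq_dep => [|X _|[? ?] [? ?] _ _ /= [-> ->]//]; exact: iota_uniq.
Qed.

Lemma ballot_word_tree n : exists L : seq (seq nat),
  [/\ uniq L, forall r, r \in L <-> ballot_word n n n r & size L = size (rule_level n)].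
Proof.
apply: (generating_tree _ (fun n => ballot_word n n n) [::] children_word
  (fun r => rem 0 (rem 1 (rem 2 r))) label_word) => //.
- by move=> r; split=> [/andP[_ /andP[/nilP]]|->].
- by move=> {}n r _; exact: label_children_word.
- move=> {}n r t _ /children_wordP[r1 [r2 [r3 [-> -> [r20 r30 r31]]]]].
  rewrite [rem 2 _]/= (rem_first _ 1 r3) // [X in rem 0 X]catA rem_first -?catA //.
  by rewrite mem_cat negb_or r30.
move=> {}n t; split.
  move=> bt; have [r1 [r2 [r3 [tE r20 r30 r31]]]] := ballot_word_column _ _ bt.
  have br : ballot_word n n n (r3 ++ r2 ++ r1).
    move: bt; rewrite /ballot_word tE content_insert_column => /andP[bt ct].
    by rewrite -(ballot_insert_column n) ?bt.
  exists (r3 ++ r2 ++ r1) => //; apply/children_wordP.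
  by exists r1, r2, r3.
case=> r br /children_wordP[r1 [r2 [r3 [rE -> [r20 r30 r31]]]]].
move: br; rewrite rE => /andP[br cr].
by rewrite /ballot_word content_insert_column cr (ballot_insert_column n) ?br.
Qed.

(** * Counting ballot words by the hook formula *)

Lemma content_cons a b c x r : content a b c (x :: r) <->
  [\/ [/\ x = 0, 0 < a & content a.-1 b c r], [/\ x = 1, 0 < b & content a b.-1 c r]
    | [/\ x = 2, 0 < c & content a b c.-1 r]].
Proof.
rewrite /content !occ_cons [size _]/=; split.
  have := occ012 r; case: x => [|[|[|x]]] /=.
  - by move=> ? ?; constructor 1; split=> //; lia.
  - by move=> ? ?; constructor 2; split=> //; lia.
  - by move=> ? ?; constructor 3; split=> //; lia.
  - by lia.
by case=> -[-> ? ?] /=; lia.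
Qed.

Lemma ballot_word_cons a b c x r : c <= b <= a ->
  ballot_word a b c (x :: r) <->
  [\/ [/\ x = 0, 0 < a & ballot_word a.-1 b c r],
      [/\ x = 1, 0 < b & ballot_word a b.-1 c r]
    | [/\ x = 2, 0 < c & ballot_word a b c.-1 r]].
Proof.
move=> abc; rewrite /ballot_word.
have bE : content a b c (x :: r) -> ballot (x :: r) = ballot r.
  by case/and4P=> _ /eqP c0 /eqP c1 /eqP c2; rewrite /ballot /= c0 c1 c2 !add0n abc andbT.
split.
  case/andP=> bx cx; move: (bx); rewrite bE // => ->.
  by move: cx => /content_cons.
move=> H; have cx : content a b c (x :: r).
  by apply/content_cons; case: H => -[? ? /andP[_ ?]]; [constructor 1|constructor 2|constructor 3].
rewrite cx bE // andbT.
by case: H => -[_ _ /andP[]].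
Qed.

Lemma ballot_word0 a b c : ~~ (c <= b <= a) -> forall r, ~~ ballot_word a b c r.
Proof.
move=> abc r; apply: contra abc => /andP[/ballot_le].
by move=> H /and4P[_ /eqP <- /eqP <- /eqP <-].
Qed.

Definition hook (a b c : nat) : rat :=
  ((a%:R - b%:R + 1) * (b%:R - c%:R + 1) * (a%:R - c%:R + 2%:R))%R.

(* Extending the range to b = a+1 and c = b+1, where there are no words and   *)
(* the formula vanishes, lets the recursion on the first letter be uniform.   *)
Lemma ballot_word_count a b c : b <= a.+1 -> c <= b.+1 -> exists L : seq (seq nat),
  [/\ uniq L, forall r, r \in L <-> ballot_word a b c r &
    ((size L * (a.+2`! * b.+1`! * c`!))%:R = (a + b + c)`!%:R * hook a b c)%R].
Proof.
have [n] := ubnP (a + b + c); elim: n a b c => // n IHn a b c lt_n ba cb.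
have [abc|abc] := boolP (c <= b <= a); last first.
  exists [::]; split=> // [r|].
    by rewrite (negPf (ballot_word0 _ _ _ abc r)).
  have : (b == a.+1) || (c == b.+1) by lia.
  rewrite mul0n /hook => /orP[] /eqP->; ring.
case: (posnP a) => [a0|a_gt0].
  have [b0 c0] : b = 0 /\ c = 0 by lia.
  exists [:: [::]]; rewrite a0 b0 c0; split=> // r.
  by rewrite inE; split=> [/eqP->|/andP[_ /andP[/nilP->]]].
have [L0 [u0 m0 s0]] : exists L : seq (seq nat), [/\ uniq L,
    forall r, r \in L <-> 0 < a /\ ballot_word a.-1 b c r &
    ((size L * (a.+2`! * b.+1`! * c`!))%:R
      = a.+2%:R * (a + b + c).-1`!%:R * hook a.-1 b c)%R].
  have [|||L [uL mL sL]] := IHn a.-1 b c; try lia.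
  exists L; split=> // [r|]; first by rewrite mL a_gt0; split=> [|[]].
  rewrite (_ : (a + b + c).-1 = a.-1 + b + c); last by lia.
  rewrite -mulrA -sL (_ : a.+1 = a.-1.+2) ?[a.-1.+2`!]factS; last by lia.
  rewrite factS (_ : a.-1.+2.+1 = a.+2); last by lia.
  by rewrite !natrM; ring.
have [L1 [u1 m1 s1]] : exists L : seq (seq nat), [/\ uniq L,
    forall r, r \in L <-> 0 < b /\ ballot_word a b.-1 c r &
    ((size L * (a.+2`! * b.+1`! * c`!))%:R = b.+1%:R * (a + b + c).-1`!%:R *
     ((a%:R - b%:R + 2%:R) * (b%:R - c%:R) * (a%:R - c%:R + 2%:R)) :> rat)%R].
  have [b0|b_gt0] := posnP b.
    have c0 : c = 0 by lia.
    exists [::]; split=> // [r|]; first by split=> // -[].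
    by rewrite b0 c0 mul0n; ring.
  have [|||L [uL mL sL]] := IHn a b.-1 c; try lia.
  exists L; split=> // [r|]; first by rewrite mL; split=> [|[]].
  case: b b_gt0 {lt_n ba cb abc s0 m0 mL} sL => // b _ sL.
  rewrite (_ : (a + b.+1 + c).-1 = a + b + c) //; last by lia.
  move: sL; rewrite /hook [b.+2`!]factS !natrM /= => sL.
  transitivity (b.+2%:R * ((a + b + c)`!%:R * hook a b c))%R; first by rewrite -sL; ring.
  by rewrite /hook -[b.+1]addn1 natrD; ring.
have [L2 [u2 m2 s2]] : exists L : seq (seq nat), [/\ uniq L,
    forall r, r \in L <-> 0 < c /\ ballot_word a b c.-1 r &
    ((size L * (a.+2`! * b.+1`! * c`!))%:R = c%:R * (a + b + c).-1`!%:R *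
     ((a%:R - b%:R + 1%:R) * (b%:R - c%:R + 2%:R) * (a%:R - c%:R + 3%:R)) :> rat)%R].
  have [c0|c_gt0] := posnP c.
    exists [::]; split=> // [r|]; first by split=> // -[].
    by rewrite c0 mul0n; ring.
  have [|||L [uL mL sL]] := IHn a b c.-1; try lia.
  exists L; split=> // [r|]; first by rewrite mL; split=> [|[]].
  case: c c_gt0 {lt_n ba cb abc s0 m0 s1 m1 mL} sL => // c _ sL.
  rewrite (_ : (a + b + c.+1).-1 = a + b + c) //; last by lia.
  move: sL; rewrite [c.+1`!]factS !natrM /= => sL.
  transitivity (c.+1%:R * ((a + b + c)`!%:R * hook a b c))%R; first by rewrite -sL; ring.
  by rewrite /hook -[c.+1]addn1 natrD; ring.
exists (map (cons 0) L0 ++ map (cons 1) L1 ++ map (cons 2) L2); split.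
- have consI x : injective (@cons nat x) by move=> ? ? [].
  rewrite !cat_uniq !map_inj_uniq // u0 u1 u2 /= andbT has_cat negb_or -!all_predC !all_map.
  rewrite -andbA; apply/and3P; split=> //; apply/allP=> r _; by apply/mapP=> -[].
- case=> [|x r].
    rewrite !mem_cat; split=> [|/andP[_ /andP[]]] /=; last by lia.
    by case/or3P=> /mapP[].
  rewrite !mem_cat ballot_word_cons //; split.
    case/or3P=> /mapP[r' r'L [-> ->]]; [constructor 1|constructor 2|constructor 3].
    + by case/m0: r'L.
    + by case/m1: r'L.
    + by case/m2: r'L.
  case=> -[-> gt0 br]; apply/or3P; [constructor 1|constructor 2|constructor 3]; apply: map_f.
  + exact/m0.
  + exact/m1.
  + exact/m2.
(* What remains is the identity [(a+2) h(a-1,b,c) + (b+1) h(a,b-1,c) + c h(a,b,c-1) = (a+b+c)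
   h(a,b,c)] of polynomials, where [h] is [hook]. *)
move: (_ * _ * _) s0 s1 s2 => F s0 s1 s2.
rewrite !size_cat !size_map !mulnDl !natrD s0 s1 s2.
case: a a_gt0 {lt_n ba abc s0 m0 s1 m1 s2 m2} => // a _.
rewrite (_ : a.+1 + b + c = (a + b + c).+1) // factS natrM /hook ![_.+1.-1]/=.
rewrite -[a.+3]addn3 -[a.+1]addn1 -[b.+1]addn1 -[(a + b + c).+1]addn1 !natrD /=; ring.
Qed.

(** * From permutations and pattern containment to words *)

Definition perm_seq {m} (w : 'S_m) : seq nat := [seq w i : nat | i <- enum 'I_m].

Lemma size_perm_seq m (w : 'S_m) : size (perm_seq w) = m.
Proof. by rewrite size_map size_enum_ord. Qed.

Lemma nth_perm_seq m (w : 'S_m) (i : 'I_m) : nth 0 (perm_seq w) i = w i.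
Proof. by rewrite (nth_map i) ?size_enum_ord // nth_ord_enum. Qed.

Lemma perm_seq_inj m : injective (@perm_seq m).
Proof.
by move=> w w' eq_w; apply/permP=> i; apply: val_inj; rewrite /= -!nth_perm_seq eq_w.
Qed.

Lemma perm_word_perm_seq m (w : 'S_m) : perm_word (perm_seq w).
Proof.
apply/andP; split.
  rewrite map_inj_uniq ?enum_uniq // => i j /val_inj; exact: perm_inj.
by rewrite size_perm_seq; apply/allP=> _ /mapP[i _ ->] /=.
Qed.

Lemma perm_word_perm_seqP m s : perm_word s -> size s = m -> exists w : 'S_m, perm_seq w = s.
Proof.
case/andP=> us /allP s_lt sz.
have lt_nth (i : 'I_m) : nth 0 s i < m.
  by have := s_lt _ (mem_nth 0 (leq_trans (ltn_ord i) (eq_leq (esym sz)))); rewrite /= sz.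
have inj : injective (fun i => Ordinal (lt_nth i)).
  by move=> i j [] /eqP; rewrite nth_uniq ?sz // => /eqP/val_inj.
exists (perm inj); apply: (@eq_from_nth _ 0); first by rewrite size_perm_seq.
move=> i; rewrite size_perm_seq => im.
by rewrite (nth_perm_seq _ (perm inj) (Ordinal im)) permE.
Qed.

Lemma alt_wordP s : reflect
  (forall i, i.+1 < size s ->
    if odd i then nth 0 s i.+1 < nth 0 s i else nth 0 s i < nth 0 s i.+1)
  (alt_word s).
Proof.
have [n] := ubnP (size s); elim: n s => // n IHn [|x [|y s]] /= lt_s; try by constructor.
have /IHn IHs : size s < n by lia.
apply: (iffP and3P) => [[xy fl /IHs alt_s]|alt_s].
  case=> [|[|i]] //= Hi; last by rewrite negbK; apply: alt_s.
  by move: fl Hi; case: (s).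
split; first exact: (alt_s 0).
  by case: (s) alt_s => // z s' /(_ 1); apply.
by apply/IHs => i Hi; have := alt_s i.+2; rewrite /= negbK; apply.
Qed.

Lemma alternatingE m (w : 'S_m) : alternating w = alt_word (perm_seq w).
Proof.
apply/forallP/alt_wordP => [alt_w i|alt_w i].
  rewrite size_perm_seq => Hi.
  have /forallP/(_ (Ordinal Hi))/implyP/(_ (eqxx _)) := alt_w (Ordinal (ltnW Hi)).
  by rewrite -!nth_perm_seq.
apply/forallP=> j; apply/implyP=> /eqP ji.
by rewrite -!nth_perm_seq ji; apply: alt_w; rewrite size_perm_seq -ji.
Qed.

(** This lets an increasing choice of positions be replaced by a subsequence of the word. *)
Lemma subseq_enum_ord m (t : seq 'I_m) :
  subseq t (enum 'I_m) = sorted ltn (map val t).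
Proof.
apply/idP/idP => [st|st].
  apply: subseq_sorted (map_subseq val st) _; first exact: ltn_trans.
  by rewrite val_enum_ord iota_ltn_sorted.
have -> : t = [seq i <- enum 'I_m | i \in t]; last exact: filter_subseq.
have lt_tr : transitive (relpre (val : 'I_m -> nat) ltn) by move=> ? ? ?; apply: ltn_trans.
apply: (irr_sorted_eq lt_tr) => [i|||i]; first exact: ltnn.
- by rewrite -sorted_map.
- by apply: sorted_filter => //; rewrite -sorted_map val_enum_ord iota_ltn_sorted.
- by rewrite mem_filter mem_enum andbT.
Qed.

Lemma subseq_mapP (T S : eqType) (f : T -> S) t s : subseq t (map f s) ->
  exists2 t', subseq t' s & t = map f t'.
Proof. by case/subseqP=> b _ ->; exists (mask b s); rewrite ?mask_subseq ?map_mask. Qed.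

Lemma contains_patternP m (w : 'S_m) (p : 'S_4) :
  reflect (exists a b c d, subseq [:: a; b; c; d] (perm_seq w) /\
     forall l r : 'I_4, (nth 0 [:: a; b; c; d] l < nth 0 [:: a; b; c; d] r) = (p l < p r))
  (contains_pattern w p).
Proof.
have nth4 (f : 'I_4 -> 'I_m) (v : 'I_m -> nat) (l : 'I_4) :
    nth 0 [:: v (f (inord 0)); v (f (inord 1)); v (f (inord 2)); v (f (inord 3))] l = v (f l).
  by case: l => -[|[|[|[|//]]]] lt_l4 /=; congr (v (f _)); apply: val_inj; rewrite /= inordK.
apply: (iffP existsP) => [[f /andP[/'forall_'forall_implyP f_mono /'forall_'forall_eqP f_pat]]|].
  pose v i := nat_of_ord (w i).
  exists (v (f (inord 0))), (v (f (inord 1))), (v (f (inord 2))), (v (f (inord 3))); split.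
    apply: (@map_subseq _ _ v
      [:: f (inord 0); f (inord 1); f (inord 2); f (inord 3)]).
    by rewrite subseq_enum_ord /= !f_mono // !inordK.
  by move=> l r; rewrite !(nth4 f v) /v f_pat.
case=> a [b [c [d [/subseq_mapP[t st tE] pat]]]].
case: t tE st => [|i0 [|i1 [|i2 [|i3 [|? ?]]]]] //.
move=> [aE bE cE dE] st; rewrite {}aE {}bE {}cE {}dE in pat.
move: st; rewrite subseq_enum_ord /= => /and4P[lt01 lt12 lt23 _].
pose f := [ffun l : 'I_4 => nth i0 [:: i0; i1; i2; i3] l].
exists f; apply/andP; split.
  apply/'forall_'forall_implyP=> l r lr; rewrite !ffunE.
  by case: l r lr => -[|[|[|[|//]]]] ? [[|[|[|[|//]]]] ?] //= _; lia.
apply/'forall_'forall_eqP=> l r; rewrite -pat !ffunE.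
by case: l r => -[|[|[|[|//]]]] ? [[|[|[|[|//]]]] ?].
Qed.

Lemma subseq_cons2 (T : eqType) (x y : T) s t :
  subseq (x :: s) (y :: t) = if x == y then subseq s t else subseq (x :: s) t.
Proof. by rewrite /=; case: eqP. Qed.

Lemma avoids1234E m (w : 'S_m) : avoids w p1234 = (chain_bound 3 (perm_seq w) == 0).
Proof.
apply/idP/idP => [|cb0]; rewrite /avoids.
  apply: contraR; rewrite -lt0n => /chain_boundP[a [t [st pt szt _]]].
  case: t szt st pt => [|b [|c [|d [|? ?]]]] // _ st /= /and4P[ab bc cd _].
  apply/contains_patternP; exists a, b, c, d; split=> // l r.
  by case: l r => -[|[|[|[|//]]]] ? [[|[|[|[|//]]]] ?]; rewrite !perm1 /=; lia.
apply: contraTN cb0 => /contains_patternP[a [b [c [d [st pat]]]]].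
rewrite -lt0n; apply/chain_boundP; exists a, [:: b; c; d]; split=> //=.
move: (pat (inord 0) (inord 1)) (pat (inord 1) (inord 2)) (pat (inord 2) (inord 3)).
by rewrite !perm1 !inordK //= => -> -> ->.
Qed.

Lemma inv_boundP s v : v < inv_bound s <->
  exists y z, subseq [:: y; z] s /\ v <= z < y.
Proof.
elim: s => [|x s IHs]; first by split=> // -[y [z []]].
rewrite [inv_bound _]/= leq_max; split.
  case/orP=> [/below_boundP[z zs vz]|/IHs[y [z [st vz]]]].
    by exists x, z; rewrite /= eqxx sub1seq.
  exists y, z; split=> //; exact: subseq_trans st (subseq_cons _ _).
case=> y [z [st vz]]; apply/orP; move: st; rewrite subseq_cons2 sub1seq.
case: eqP => [yx zs|_ st]; [left|right].
  by apply/below_boundP; exists z; rewrite // -yx.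
by apply/IHs; exists y, z.
Qed.

Lemma activePn s v : ~~ active s v <->
  exists b c d, subseq [:: b; c; d] s /\ [/\ b < v, v <= d & d < c].
Proof.
elim: s => [|x s IHs]; first by split=> // -[b [c [d []]]].
rewrite [active _ _]/= negb_and negb_imply -ltnNge; split.
  case/orP=> [/IHs[b [c [d [st bvdc]]]]|/andP[xv /inv_boundP[c [d [st /andP[vd dc]]]]]].
    by exists b, c, d; split=> //; exact: subseq_trans st (subseq_cons _ _).
  by exists x, c, d; rewrite /= eqxx.
case=> b [c [d [st [bv vd dc]]]]; apply/orP; move: st; rewrite subseq_cons2.
case: eqP => [bx st|_ st]; [right|left].
  by rewrite -bx bv; apply/inv_boundP; exists c, d; rewrite vd.
by apply/IHs; exists b, c, d.
Qed.

Lemma avoids2143Pn s : uniq s -> ~~ avoids2143 s <->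
  exists a b c d, subseq [:: a; b; c; d] s /\ [/\ b < a, a < d & d < c].
Proof.
elim: s => [|x s IHs] us; first by split=> // -[a [b [c [d []]]]].
have {}IHs := IHs (proj2 (andP us)).
rewrite [avoids2143 _]/= negb_and; split.
  case/orP=> [/IHs[a [b [c [d [st ?]]]]]|/activePn[b [c [d [st [bx xd dc]]]]]].
    by exists a, b, c, d; split=> //; exact: subseq_trans st (subseq_cons _ _).
  exists x, b, c, d; rewrite /= eqxx; split=> //; split=> //.
  (* [active] treats [x] as a gap and so permits [d = x]; distinctness of the letters makes the
     inequality strict. *)
  rewrite ltn_neqAle xd andbT; apply: contraTneq us => ->.
  by rewrite /= (mem_subseq st) // !inE eqxx !orbT.
case=> a [b [c [d [st [ba ad dc]]]]]; apply/orP; move: st.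
rewrite subseq_cons2; case: eqP => [ax st|_ st]; [right|left].
  by apply/activePn; exists b, c, d; rewrite -ax (ltnW ad).
by apply/IHs; exists a, b, c, d.
Qed.

Lemma p2143E (l : 'I_4) : p2143 l = nth 0 [:: 1; 0; 3; 2] l :> nat.
Proof.
have: nth 0 (word p2143) l = (p2143 l).+1.
  by rewrite (nth_map l) ?size_enum_ord // nth_ord_enum.
by rewrite word_p2143; case: l => -[|[|[|[|//]]]] ? [].
Qed.

Lemma avoids2143E m (w : 'S_m) : avoids w p2143 = avoids2143 (perm_seq w).
Proof.
have /andP[us _] := perm_word_perm_seq _ w.
apply/idP/idP => [|avw]; rewrite /avoids.
  apply: contraR => /(avoids2143Pn _ us)[a [b [c [d [st [ba ad dc]]]]]].
  apply/contains_patternP; exists a, b, c, d; split=> // l r; rewrite !p2143E.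
  by case: l r => -[|[|[|[|//]]]] ? [[|[|[|[|//]]]] ?] /=; lia.
apply: contraTN avw => /contains_patternP[a [b [c [d [st pat]]]]].
apply/(avoids2143Pn _ us); exists a, b, c, d; split=> //.
move: (pat (inord 1) (inord 0)) (pat (inord 0) (inord 3)) (pat (inord 3) (inord 2)).
by rewrite !p2143E !inordK //= => -> -> ->.
Qed.

Lemma card_alt_avoiding n (p : 'S_4) (av : seq nat -> bool) (L : seq (seq nat)) :
    (forall w : 'S_(2 * n), avoids w p = av (perm_seq w)) -> uniq L ->
    (forall s, s \in L <-> alt_perm_word n s && av s) ->
  #|alt_avoiding (2 * n) p| = size L.
Proof.
move=> avE uL LP; rewrite cardE -(size_map perm_seq); apply/perm_size/uniq_perm => //.
  by rewrite map_inj_uniq ?enum_uniq //; exact: perm_seq_inj.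
move=> s; apply/mapP/idP => [[w]|].
  rewrite mem_enum inE alternatingE avE => /andP[altw avw] ->; apply/LP.
  by rewrite avw andbT; apply/and3P; split=> //; rewrite ?perm_word_perm_seq ?size_perm_seq.
case/LP/andP=> /and3P[pw /eqP sz alts] avs.
have [w wE] := perm_word_perm_seqP _ _ pw sz.
by exists w; rewrite // mem_enum inE alternatingE avE wE alts.
Qed.

(** * Standard tableaux as ballot words *)

Lemma ballot_revP s : reflect
  (forall k, k <= size s -> occ 2 (take k s) <= occ 1 (take k s) <= occ 0 (take k s))
  (ballot (rev s)).
Proof.
have occ_rev x (t : seq nat) : occ x (rev t) = occ x t by rewrite /occ count_rev.
elim/last_ind: s => [|s x IHs]; first by constructor=> -[].
rewrite rev_rcons /ballot /= -/(ballot _) !add0n -rev_rcons !occ_rev.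
apply: (iffP andP) => [[/IHs bs bx] k|bs].
  rewrite size_rcons leq_eqVlt => /predU1P[->|ks].
    by rewrite -(size_rcons s x) take_size.
  by rewrite -cats1 takel_cat //; apply: bs.
have := bs _ (leqnn _); rewrite take_size => ->; split=> //.
apply/IHs => k ks; have := bs k; rewrite -cats1 takel_cat // => -> //.
by rewrite size_cat addn1; apply: leqW.
Qed.

Definition positions x (s : seq nat) := [seq v <- iota 0 (size s) | nth 0 s v == x].

Lemma positions_sorted x s : sorted ltn (positions x s).
Proof. by apply: sorted_filter (iota_ltn_sorted _ _); apply: ltn_trans. Qed.

Lemma mem_positions x s v : (v \in positions x s) = (nth 0 s v == x) && (v < size s).
Proof. by rewrite mem_filter mem_iota. Qed.

Lemma occ_take x s k : k <= size s -> occ x (take k s) = count (gtn k) (positions x s).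
Proof.
move=> ks; rewrite /positions -(subnKC ks) iotaD filter_cat count_cat add0n !count_filter.
rewrite [X in _ + X](_ : _ = 0) ?addn0; last first.
  rewrite -(count_pred0 (iota k (size s - k))); apply: eq_in_count => v.
  by rewrite mem_iota /=; lia.
rewrite /occ -[take k s](@mkseq_nth _ 0) size_takel // count_map.
by apply: eq_in_count => v; rewrite mem_iota /= => vk; rewrite nth_take ?vk.
Qed.

Lemma occ_positions x s : occ x s = size (positions x s).
Proof.
rewrite -{1}[s]take_size occ_take // -(@count_predT _ (positions x s)).
by apply: eq_in_count => v; rewrite mem_positions => /andP[].
Qed.

(** This translates between prefix counts of a letter and the entries of the corresponding row. *)
Lemma count_gtn_sorted p j k : sorted ltn p -> j < size p ->
  (j < count (gtn k) p) = (nth 0 p j < k).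
Proof.
elim: p j => //= x p IHp j xp jp; have sp := path_sorted xp.
case: (ltnP x k) => kx.
  by case: j jp => [|j] jp /=; rewrite ?kx // add1n ltnS IHp.
have c0 : count (gtn k) p = 0.
  apply/eqP; rewrite -leqn0 leqNgt -has_count; apply/hasPn=> y yp /=.
  have /allP/(_ _ yp) /= := order_path_min ltn_trans xp.
  by rewrite -leqNgt => /ltnW; apply: leq_trans.
rewrite c0 addn0; case: j jp => [|j] jp /=; first by rewrite [RHS]ltnNge kx.
by rewrite -IHp // c0.
Qed.

Section TableauWord.

Variable n : nat.

Implicit Type T : {ffun 'I_3 * 'I_n -> 'I_(3 * n)}.

Definition entry_row T (v : 'I_(3 * n)) : nat :=
  if [pick b | T b == v] is Some b then b.1 else 0.

Definition tableau_word T := [seq entry_row T v | v <- enum 'I_(3 * n)].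

Lemma size_tableau_word T : size (tableau_word T) = 3 * n.
Proof. by rewrite size_map size_enum_ord. Qed.

Lemma nth_tableau_word T (v : 'I_(3 * n)) : nth 0 (tableau_word T) v = entry_row T v.
Proof. by rewrite (nth_map v) ?size_enum_ord // nth_ord_enum. Qed.

Lemma SYT_nnnP T : reflect
  [/\ injective T, forall i (j j' : 'I_n), j < j' -> T (i, j) < T (i, j')
    & forall (i i' : 'I_3) j, i < i' -> T (i, j) < T (i', j)]
  (T \in SYT_nnn n).
Proof.
rewrite inE; apply: (iffP and3P) => -[H rowT colT]; split.
- move=> b b' bb'; have /forallP/(_ (T b))/cards1P[c cE] := H.
  have : b \in [set b | T b == T b'] by rewrite inE bb'.
  have : b' \in [set b | T b == T b'] by rewrite inE.
  by rewrite -bb' cE !inE => /eqP-> /eqP->.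
- by move=> i j j'; apply/implyP; move/forallP/(_ i)/forallP/(_ j)/forallP: rowT; apply.
- by move=> i i' j; apply/implyP; move/forallP/(_ i)/forallP/(_ i')/forallP: colT; apply.
- have [|g gK Kg] := inj_card_bij H; first by rewrite card_prod !card_ord.
  apply/forallP=> v; apply/cards1P; exists (g v); apply/setP=> b.
  by rewrite !inE -(can_eq gK) Kg.
- by apply/'forall_'forall_'forall_implyP.
- by apply/'forall_'forall_'forall_implyP.
Qed.

Lemma entry_rowE T b : injective T -> entry_row T (T b) = b.1.
Proof.
move=> injT; rewrite /entry_row; case: pickP => [b' /eqP/injT->//|/(_ b)].
by rewrite eqxx.
Qed.

Lemma positions_tableau_word T (i : 'I_3) : T \in SYT_nnn n ->
  positions i (tableau_word T) = [seq T (i, j) : nat | j <- enum 'I_n].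
Proof.
case/SYT_nnnP=> injT rowT _.
have [|g gK Kg] := inj_card_bij injT; first by rewrite card_prod !card_ord.
apply: (irr_sorted_eq ltn_trans ltnn (positions_sorted _ _)).
  apply: (homo_sorted (e := relpre val ltn)); first by move=> j j'; apply: rowT.
  by rewrite -sorted_map val_enum_ord iota_ltn_sorted.
move=> v; rewrite mem_positions size_tableau_word; apply/andP/mapP => [[]|[j _ ->]].
  move=> + vn; rewrite (nth_tableau_word T (Ordinal vn)) -[Ordinal vn]Kg entry_rowE //.
  move=> /eqP/val_inj gi; exists (g (Ordinal vn)).2; first by rewrite mem_enum.
  by rewrite -gi -surjective_pairing Kg.
by rewrite nth_tableau_word entry_rowE /=.
Qed.

Lemma tableau_word_inj : {in SYT_nnn n &, injective tableau_word}.
Proof.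
move=> T T' sT sT' eqw; apply/ffunP=> -[i j]; apply: val_inj.
have := positions_tableau_word T i sT.
rewrite eqw positions_tableau_word // => /eq_in_map/(_ j).
by rewrite mem_enum => /(_ isT).
Qed.

Lemma ballot_tableau_word T : T \in SYT_nnn n -> ballot_word n n n (rev (tableau_word T)).
Proof.
move=> sT; have [_ _ colT] := SYT_nnnP _ sT.
have pos i := positions_tableau_word T i sT.
have ord_nat (P : nat -> Prop) : (forall i : 'I_3, P i) -> [/\ P 0, P 1 & P 2].
  by move=> P3; split; [exact: (P3 (@Ordinal 3 0 isT)) | exact: (P3 (@Ordinal 3 1 isT))
    | exact: (P3 (@Ordinal 3 2 isT))].
apply/andP; split.
  apply/ballot_revP => k ks; rewrite !occ_take //.
  have le (i i' : 'I_3) : i < i' ->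
      count (gtn k) (positions i' (tableau_word T)) <= count (gtn k) (positions i (tableau_word T)).
    move=> ii'; rewrite !pos !count_map; apply: sub_count => j /=.
    by apply: ltn_trans; apply: colT.
  rewrite (le (@Ordinal 3 1 isT) (@Ordinal 3 2 isT)) //=.
  exact: (le (@Ordinal 3 0 isT) (@Ordinal 3 1 isT)).
have [|o0 o1 o2] := ord_nat (fun i => occ i (rev (tableau_word T)) = n).
  move=> i; rewrite /occ count_rev -/(occ _ _) occ_positions pos size_map.
  by rewrite size_enum_ord.
rewrite /content o0 o1 o2 size_rev size_tableau_word !eqxx.
by apply/and4P; split=> //; apply/eqP; lia.
Qed.

Lemma tableau_of_word s : ballot_word n n n (rev s) ->
  exists2 T, T \in SYT_nnn n & tableau_word T = s.
Proof.
case/andP=> /ballot_revP bs /and4P[/eqP]; rewrite size_rev /occ !count_rev -!/(occ _ _).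
move=> sz /eqP o0 /eqP o1 /eqP o2.
have size_pos (i : 'I_3) : size (positions i s) = n.
  by rewrite -occ_positions; case: i => -[|[|[|//]]].
have lt_pos (b : 'I_3 * 'I_n) : nth 0 (positions b.1 s) b.2 < 3 * n.
  have: nth 0 (positions b.1 s) b.2 \in positions b.1 s by rewrite mem_nth ?size_pos.
  by rewrite mem_positions => /andP[_]; lia.
(* Row [i] of the tableau lists the positions of the letter [i]. *)
pose T : {ffun 'I_3 * 'I_n -> 'I_(3 * n)} := [ffun b => Ordinal (lt_pos b)].
have TE i j : T (i, j) = nth 0 (positions i s) j :> nat by rewrite ffunE.
have nthT b : nth 0 s (T b) = b.1.
  rewrite ffunE /=; apply/eqP.
  have: nth 0 (positions b.1 s) b.2 \in positions b.1 s by rewrite mem_nth ?size_pos.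
  by rewrite mem_positions => /andP[].
have injT : injective T.
  move=> [i j] [i' j'] eqT; have := nthT (i, j); rewrite eqT nthT /= => /val_inj ii'.
  move: eqT; rewrite {}ii' => /(congr1 val)/eqP /=; rewrite !TE nth_uniq ?size_pos //.
    by move=> /eqP/val_inj->.
  exact: sorted_uniq ltn_trans ltnn _ (positions_sorted _ _).
have sT : T \in SYT_nnn n.
  apply/SYT_nnnP; split=> // [i j j' jj'|i i' j ii'].
    rewrite !TE (sorted_ltn_nth ltn_trans) ?inE ?size_pos //; exact: positions_sorted.
  (* The prefix ending at [T (i', j)] has more than [j] letters [i'], hence more than [j] letters
     [i]; so [T (i, j)] lies in that prefix too. *)
  have Ts : (T (i', j)).+1 <= size s by have := ltn_ord (T (i', j)); lia.
  have occ_le : occ i' (take (T (i', j)).+1 s) <= occ i (take (T (i', j)).+1 s).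
    have := bs _ Ts; move: ii'.
    by case: (i) => -[|[|[|//]]] ?; case: (i') => -[|[|[|//]]] ? //= _; lia.
  rewrite ltn_neqAle; apply/andP; split.
    by apply/negP=> /eqP/val_inj/injT[] ii; rewrite ii ltnn in ii'.
  rewrite -ltnS [T (i, j) : nat]TE -count_gtn_sorted ?size_pos ?positions_sorted //.
  rewrite -occ_take //; apply: leq_trans occ_le.
  by rewrite occ_take // count_gtn_sorted ?size_pos ?positions_sorted // -TE.
exists T => //; apply: (@eq_from_nth _ 0); first by rewrite size_tableau_word; lia.
move=> v; rewrite size_tableau_word => vn.
have [|g gK Kg] := inj_card_bij injT; first by rewrite card_prod !card_ord.
rewrite (nth_tableau_word T (Ordinal vn)) -[Ordinal vn]Kg entry_rowE //.
by rewrite -nthT Kg.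
Qed.

Lemma card_SYT_nnn (L : seq (seq nat)) :
    uniq L -> (forall r, r \in L <-> ballot_word n n n r) -> #|SYT_nnn n| = size L.
Proof.
move=> uL LP; rewrite cardE -(size_map (rev \o tableau_word)); apply/perm_size/uniq_perm => //.
  rewrite map_inj_in_uniq ?enum_uniq // => T T'; rewrite !mem_enum => sT sT' /= eqw.
  by apply: tableau_word_inj => //; apply: (can_inj revK).
move=> r; apply/mapP/idP => [[T]|/LP br].
  by rewrite mem_enum => sT ->; apply/LP; apply: ballot_tableau_word.
have [|T sT Tr] := tableau_of_word (rev r); first by rewrite revK.
by exists T; rewrite /= ?Tr ?revK // mem_enum.
Qed.

End TableauWord.

Theorem theorem4p6 (n : nat) (hn : 1 <= n) :
  [/\ #|alt_avoiding (2 * n) p2143| = #|SYT_nnn n|,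
      #|SYT_nnn n| = #|alt_avoiding (2 * n) p1234| &
      ((#|alt_avoiding (2 * n) p1234|)%:R =
       (2 * (3 * n)`!)%:R / (n`! * (n + 1)`! * (n + 2)`!)%:R :> rat)%R].
Proof.
have [L1 [u1 m1 s1]] := alt2143_tree n.
have [L2 [u2 m2 s2]] := alt1234_tree n.
have [L3 [u3 m3 s3]] := ballot_word_tree n.
have [L4 [u4 m4 s4]] := ballot_word_count n n n (leqnSn n) (leqnSn n).
have card1 := card_alt_avoiding _ _ _ _ (avoids2143E _) u1 m1.
have card2 := card_alt_avoiding _ _ _ _ (avoids1234E _) u2 m2.
have card3 := card_SYT_nnn _ _ u3 m3; have card4 := card_SYT_nnn _ _ u4 m4.
split; first by rewrite card1 card3 s1 s3.
  by rewrite card2 card3 s2 s3.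
have -> : #|alt_avoiding (2 * n) p1234| = size L4 by rewrite card2 s2 -s3 -card3.
have den0 : ((n`! * (n + 1)`! * (n + 2)`!)%:R != 0 :> rat)%R.
  by rewrite Num.Theory.pnatr_eq0 -lt0n !muln_gt0 !fact_gt0.
apply: (mulIf den0); rewrite mulfVK // -natrM addn1 addn2.
have -> : size L4 * (n`! * n.+1`! * n.+2`!) = size L4 * (n.+2`! * n.+1`! * n`!) by lia.
rewrite s4 (_ : n + n + n = 3 * n); last by lia.
(* On the diagonal [hook n n n = 1 * 1 * 2], the factor 2 of the formula. *)
by rewrite /hook natrM; ring.
Qed.
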